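(* For an infinite tournament $G\in\mathfrak{Out}_\infty$ the following are equivalent: (i) $G\notin\mathfrak{Out}_3$; (ii) $G\notin\mathfrak{Out}_n$ for each integer $n\ge 3$; (iii) there is a surjective homomorphism $\varphi:G\to\mathbb T_3$.
   Context: A tournament is a digraph $G=(V,E)$ such that for any two distinct $x,y\in V$ exactly one of $(x,y),(y,x)$ is in $E$. A set $A\subseteq V$ is independent if there is no edge (in either direction) between two distinct elements of $A$. For $n\in\mathbb N$ and $A\subseteq V$, $\mathrm{Out}^G_n(A)$ is the set of all $v\in V$ such that there is a directed path of length at most $n$ from some point of $A$ to $v$ (length $0$ allowed), and $\mathrm{Out}^G_\infty(A)=\bigcup_{n\in\mathbb N}\mathrm{Out}^G_n(A)$. For $n\in\mathbb N\cup\{\infty\}$, $G\in\mathfrak{Out}_n$ iff there is an independent set $A\subseteq V$ with $V=\mathrm{Out}^G_n(A)$. $\mathbb T_3$ is the digraph with vertex set $\mathbb N=\{0,1,2,\dots\}$ and edge set $\{(x,y):x\ge y\}\cup\{(x,x+1):x\in\mathbb N\}$ (loops included). A homomorphism of digraphs is a map of vertex sets sending edges to edges. *)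

(* Defs.v *)
From mathcomp Require Import all_boot.
From mathcomp Require Import classical_sets cardinality.
Set Implicit Arguments.
Unset Strict Implicit.
Unset Printing Implicit Defensive.

Local Open Scope classical_set_scope.

(* A digraph is given by its edge relation [E : rel V]; loops are allowed. *)

Definition tournament (V : eqType) (E : rel V) : Prop :=
  forall x y : V, x != y -> E x y (+) E y x.

Definition independent (V : eqType) (E : rel V) (A : set V) : Prop :=
  forall x y : V, A x -> A y -> x != y -> ~~ E x y.

(* The vertices of a directed path are [a :: p], so its length is [size p];
   [path] by itself only describes walks, hence the [uniq]. *)
Definition dipath (V : eqType) (E : rel V) (a : V) (p : seq V) (v : V) : Prop :=
  [/\ path E a p, uniq (a :: p) & last a p = v].

Definition Out (V : eqType) (E : rel V) (n : nat) (A : set V) : set V :=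
  [set v | exists a p, [/\ A a, dipath E a p v & size p <= n]].

Definition Out_infty (V : eqType) (E : rel V) (A : set V) : set V :=
  \bigcup_n Out E n A.

Definition class_Out (V : eqType) (E : rel V) (n : nat) : Prop :=
  exists A : set V, independent E A /\ [set: V] = Out E n A.

Definition class_Out_infty (V : eqType) (E : rel V) : Prop :=
  exists A : set V, independent E A /\ [set: V] = Out_infty E A.

Definition T3 : rel nat := fun x y => (y <= x) || (y == x.+1).

Definition homomorphism (V W : eqType) (E : rel V) (F : rel W) (f : V -> W) : Prop :=
  {homo f : x y / E x y >-> F x y}.

(* Main.v *)
Require Import Defs.
From mathcomp Require Import all_boot.
From mathcomp Require Import boolp classical_sets functions cardinality.
Local Open Scope classical_set_scope.

(** In a tournament independent sets are at most singletons, so [class_Out E n]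
    says that some root [a] reaches every vertex in at most [n] steps.
    If [a] reaches everything in [n+1 >= 2] steps but [v] is not reached in [n]
    steps, then [v] dominates the ball of radius [n-1] around [a], whence [v]
    reaches everything in 3 steps; thus membership in any [Out_n] descends to
    [Out_3]. If no [Out_n] contains the tournament, the distance from a root
    witnessing [Out_infty] is a homomorphism to [T3] with all levels nonempty.
    Conversely, a homomorphism to [T3] increases by at most 1 along each edge,
    so it is bounded when the radius is finite. *)

Section Out.
Set Implicit Arguments.
Unset Strict Implicit.
Context (V : eqType) (E : rel V).
Implicit Types (A : set V) (n m : nat).

Lemma Out_refl n A a : A a -> Out E n A a.
Proof. by move=> Aa; exists a, [::]; split. Qed.

Lemma Out_mono m n A : m <= n -> Out E m A `<=` Out E n A.
Proof.
by move=> mn v [a [p [Aa pv pm]]]; exists a, p; split=> //; apply: leq_trans mn.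
Qed.

(** Appending an edge may revisit a vertex and give only a walk; [shortenP] cuts it to a path on
    some of the same vertices, hence no longer. *)
Lemma Out_step n A x y : Out E n A x -> E x y -> Out E n.+1 A y.
Proof.
move=> [a [p [Aa [pathp _ lastp] sizep]]] Exy.
have: path E a (rcons p y) by rewrite rcons_path pathp lastp.
have: last a (rcons p y) = y by rewrite last_rcons.
have: size (rcons p y) <= n.+1 by rewrite size_rcons.
move=> sz lst /shortenP pP; case: pP lst => q pathq uniqq subq lst.
exists a, q; split => //.
apply: leq_trans sz; apply: uniq_leq_size => //.
by case/andP: uniqq.
Qed.

Lemma Out_succ n A y : Out E n.+1 A y ->
  Out E n A y \/ exists2 x, Out E n A x & E x y.
Proof.
move=> [a [p [Aa]]]; case/lastP: p => [|p z].
  by case=> _ _ /= <- _; left; apply: Out_refl.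
case; rewrite last_rcons rcons_path size_rcons -rcons_cons rcons_uniq.
move=> /andP[pathp Ez] /andP[_ uniqp] <- sizep.
by right; exists (last a p) => //; exists a, p.
Qed.

Lemma Out_zero A : Out E 0 A `<=` A.
Proof. by move=> v [a [p [Aa [_ _ <-]]]]; rewrite leqn0 => /nilP ->. Qed.

Lemma Out_infty_sub A B : A `<=` B ->
  (forall x y, B x -> E x y -> B y) -> Out_infty E A `<=` B.
Proof.
move=> AB Bstep v [n _]; elim: n v => [|n IH] v; first by move/Out_zero/AB.
by case/Out_succ => [/IH //|[x /IH Bx /Bstep]]; apply.
Qed.

Lemma homomorphism_T3_Out (phi : V -> nat) n A v : homomorphism E T3 phi ->
  Out E n A v -> exists2 a, A a & phi v <= phi a + n.
Proof.
move=> hom; elim: n v => [|n IH] v.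
  by move/Out_zero => Av; exists v => //; rewrite addn0.
case/Out_succ => [/IH[a Aa le]|[x /IH[a Aa le] Exv]]; exists a => //.
  by rewrite addnS ltnW.
rewrite addnS; case/orP: (hom _ _ Exv) => [vx|/eqP ->]; last by rewrite ltnS.
by apply/ltnW; apply: leq_ltn_trans vx _; rewrite ltnS.
Qed.

Lemma independent1 a : independent E [set a].
Proof. by move=> x y -> ->; rewrite eqxx. Qed.

Lemma independent_tournament A x y :
  tournament E -> independent E A -> A x -> A y -> x = y.
Proof.
move=> tour indep Ax Ay; apply/eqP/negPn/negP => neq.
have:= tour _ _ neq.
by rewrite (negbTE (indep _ _ Ax Ay neq)) (negbTE (indep _ _ Ay Ax _)) // eq_sym.
Qed.

Lemma class_OutI n A : independent E A -> (forall v, Out E n A v) ->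
  class_Out E n.
Proof. by move=> indep all; exists A; split=> //; apply/seteqP; split. Qed.

Lemma class_Out_mono m n : m <= n -> class_Out E m -> class_Out E n.
Proof.
move=> mn [A [indep VA]]; apply: (@class_OutI _ A) => // v.
by apply: (Out_mono mn); rewrite -VA.
Qed.

(** An edge from [x] to [v] would put [v] within [n.+1] steps of [A], so the pair is oriented the
    other way. *)
Lemma tournament_Out_dominated n A v x : tournament E ->
  ~ Out E n.+1 A v -> Out E n A x -> E v x.
Proof.
move=> tour nv Ox; have xv : x != v.
  by apply/eqP => xv; apply: nv; rewrite -xv; apply: Out_mono Ox.
have := tour _ _ xv; case: (boolP (E x v)) => [Exv|//].
by case: nv; apply: Out_step Ox Exv.
Qed.

Lemma tournament_class_Out3 n : tournament E -> class_Out E n -> class_Out E 3.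
Proof.
move=> tour; elim: n => [|n IH]; first exact: class_Out_mono.
(* Radius 1 follows by monotonicity; the descent needs radius at least 2. *)
case: n IH => [|n] IH; first by move=> ?; apply: (@class_Out_mono 1).
move=> [A [indep VA]].
case: (pselect (forall v, Out E n.+1 A v)) => [all|/existsNP[v nv]].
  exact/IH/(class_OutI indep).
apply: (class_OutI (@independent1 v)).
(* The balls of radius [n], [n.+1], [n.+2] around [A] lie in those of radius 1, 2, 3 around [v]. *)
have out1 x : Out E n A x -> Out E 1 [set v] x.
  move=> /(tournament_Out_dominated tour nv); apply: Out_step.
  exact: Out_refl.
have out2 x : Out E n.+1 A x -> Out E 2 [set v] x.
  case/Out_succ => [/out1|[y /out1 Oy /(Out_step Oy)//]].
  exact: Out_mono.
move=> x; have : Out E n.+2 A x by rewrite -VA.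
case/Out_succ => [/out2|[y /out2 Oy /(Out_step Oy)//]].
exact: Out_mono.
Qed.

Lemma distance_homomorphism A : [set: V] = Out_infty E A ->
  independent E A -> (forall n, ~ class_Out E n) ->
  exists phi : V -> nat,
    homomorphism E T3 phi /\ set_surj [set: V] [set: nat] phi.
Proof.
move=> VA indep nOut.
have exOut v : exists n, `[< Out E n A v >].
  have [n _ On] : Out_infty E A v by rewrite -VA.
  by exists n; apply/asboolP.
pose phi v := ex_minn (exOut v).
have phiP v : Out E (phi v) A v.
  by rewrite /phi; case: ex_minnP => m /asboolP.
have phi_le v n : Out E n A v -> phi v <= n.
  by move=> On; rewrite /phi; case: ex_minnP => m _; apply; apply/asboolP.
exists phi; split=> [x y Exy|n _].
  have := phi_le _ _ (Out_step (phiP x) Exy).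
  by rewrite /T3 leq_eqVlt ltnS orbC.
apply: contrapT => nphi.
have nphiE v : phi v <> n by move=> phin; apply: nphi; exists v.
(* An empty level [n] adds nothing to the ball of radius [n.-1]. *)
have down v : Out E n A v -> Out E n.-1 A v.
  move=> /phi_le; rewrite leq_eqVlt => /orP[/eqP/nphiE//|lt].
  by apply: Out_mono (phiP v); case: n lt {nphi nphiE}.
case: n => [|n] in nphi nphiE down *.
  (* Points of [A] have distance 0, so an empty level 0 empties [A] and then [V]. *)
  have sub : Out_infty E A `<=` set0.
    apply: Out_infty_sub => // a Aa; apply: (nphiE a); apply/eqP.
    by rewrite -leqn0; apply: phi_le; apply: Out_refl.
  apply: (nOut 0); apply: (class_OutI indep) => v.
  by have /sub : Out_infty E A v by rewrite -VA.
(* By [down], the ball of radius [n] is closed under edges, so it is all of [V]. *)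
apply: (nOut n); apply: (class_OutI indep) => v.
have : Out_infty E A v by rewrite -VA.
apply: Out_infty_sub => [a Aa|x y Ox Exy]; first exact: Out_refl.
by apply: down; apply: Out_step Ox Exy.
Qed.

End Out.

Theorem theorem4p2 (V : eqType) (E : rel V) (V_inf : infinite_set [set: V])
    (E_tour : tournament E) (E_Out : class_Out_infty E) :
  [<-> ~ class_Out E 3;
       forall n : nat, 3 <= n -> ~ class_Out E n;
       exists phi : V -> nat,
         homomorphism E T3 phi /\ set_surj [set: V] [set: nat] phi].
Proof.
tfae.
- by move=> nOut3 n _ /(tournament_class_Out3 E_tour).
- move=> nOut; case: E_Out => A [indep VA].
  apply: (distance_homomorphism VA indep) => n On.
  apply: (nOut (maxn n 3)); first exact: leq_maxr.
  by apply: class_Out_mono On; apply: leq_maxl.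
- move=> [phi [hom surj]] [A [indep VA]].
  have bound v : exists2 a, A a & phi v <= phi a + 3.
    by apply: (homomorphism_T3_Out hom); rewrite -VA.
  (* Any vertex supplies a root [a], unique by independence; level [phi a + 4] is the first one out
     of its reach in 3 steps. *)
  have [v0 _ _] := surj 0 I; have [a Aa _] := bound v0.
  have [v _ phiv] := surj (phi a + 4) I; have [b Ab] := bound v.
  rewrite (independent_tournament E_tour indep Ab Aa) phiv.
  by rewrite leq_add2l.
Qed.
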